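(* Let $\Omega\subsetneq\mathbb{R}^n$ be a domain, $1<p<\infty$, and suppose that there are $c_0>0$, $C_0\ge2$ and $0\le\lambda\le n-1$ with $$\mathcal H^\lambda_\infty\bigl(\partial_x^{\mathrm{dir}}\Omega\cap B(x,C_0d_\Omega(x))\bigr)\ge c_0\,d_\Omega(x)^\lambda\qquad\text{for every }x\in\Omega .$$ Then $\Omega$ admits the $(p,\beta)$-Hardy inequality for every $\beta<p-n+\lambda$.
   Context: A domain is a nonempty connected open set. $d_\Omega(y):=\operatorname{dist}(y,\partial\Omega)$; $B(y,r)$ is the open ball. For $x\ne\xi$, $[x,\xi):=\{(1-t)x+t\xi:0\le t<1\}$, and $\partial_x^{\mathrm{dir}}\Omega:=\{\xi\in\partial\Omega:[x,\xi)\subset\Omega\}$. The $\lambda$-Hausdorff content of $E\subset\mathbb{R}^n$ is $\mathcal H^\lambda_\infty(E):=\inf\{\sum_i r_i^\lambda: E\subset\bigcup_i B(x_i,r_i)\}$, the infimum over (at most) countable covers by balls. For $1<p<\infty$ and $\beta\in\mathbb{R}$, $\Omega$ admits the $(p,\beta)$-Hardy inequality if there is a constant $C>0$ with $$\int_\Omega |u(x)|^p d_\Omega(x)^{\beta-p}\,dx\le C\int_\Omega|\nabla u(x)|^p d_\Omega(x)^\beta\,dx\qquad\text{for every }u\in C_c^\infty(\Omega).$$ Known result the paper uses as given (Lehrbäck): if $\Omega\subset\mathbb{R}^n$ is open, $1<p<\infty$, and for some $0\le\lambda\le n-1$ and $c>0$ one has $\mathcal H^\lambda_\infty(\partial\Omega\cap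 B(x,2d_\Omega(x)))\ge c\,d_\Omega(x)^\lambda$ for every $x\in\Omega$, then $\Omega$ admits the $(p,\beta)$-Hardy inequality for all $\beta<p-n+\lambda$. *)

(* Defs.v *)
From HB Require Import structures.
From mathcomp Require Import all_boot all_order all_algebra.
From mathcomp Require Import all_classical all_reals all_analysis.

Set Implicit Arguments.
Unset Strict Implicit.
Unset Printing Implicit Defensive.

Import Order.TTheory GRing.Theory Num.Theory.
Import numFieldNormedType.Exports.

Local Open Scope classical_set_scope.
Local Open Scope ring_scope.

(** ** Lebesgue measure on ['rV[R]_n] *)

(** The library has a sigma-algebra on tuples but none on row vectors; this is
    the same one, generated by the coordinates. *)
Section rV_measurable.
Context (R : realType) (n : nat).
Local Notation T := (measurableTypeR R).

Let coords (i : 'I_n) (x : 'rV[R]_n) : T := x ord0 i.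

Let rV_set0 : g_sigma_preimage coords set0.
Proof. exact: sigma_algebra0. Qed.

Let rV_setC A : g_sigma_preimage coords A -> g_sigma_preimage coords (~` A).
Proof. exact: sigma_algebraC. Qed.

Let rV_bigcup (F : _^nat) : (forall i, g_sigma_preimage coords (F i)) ->
  g_sigma_preimage coords (\bigcup_i (F i)).
Proof. exact: sigma_algebra_bigcup. Qed.

HB.instance Definition _ := @isMeasurable.Build default_measure_display
  'rV[R]_n (g_sigma_preimage coords) rV_set0 rV_setC rV_bigcup.

End rV_measurable.

Section rV_measurable_fun.
Context (R : realType) (n : nat).
Local Notation T := (measurableTypeR R).

Lemma measurable_rV_coord (i : 'I_n) :
  measurable_fun [set: 'rV[R]_n] (fun x => x ord0 i : T).
Proof.
move=> _ Y mY; rewrite setTI; apply: sub_sigma_algebra => /=.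
rewrite -bigcup_seq/=; exists i => /=; first by rewrite mem_index_enum.
by exists Y => //; rewrite setTI.
Qed.

Lemma measurable_fun_rV d (T1 : measurableType d) (f : T1 -> 'rV[R]_n) :
  (forall i, measurable_fun [set: T1] (fun x => f x ord0 i : T)) ->
  measurable_fun [set: T1] f.
Proof.
move=> mf; suff fS : g_sigma_preimage (fun i x => f x ord0 i : T)
    `<=` @measurable _ T1.
  move=> _ A mA; apply: fS; rewrite setTI.
  rewrite (_ : (fun _ => _) = (fun i => (fun x : 'rV[R]_n => x ord0 i : T) \o f))//.
  by rewrite g_sigma_preimage_comp; exists A => //; rewrite setTI.
apply: smallest_sub; first exact: sigma_algebra_measurable.
rewrite -bigcup_seq => A [i _ [B mB <-]]; exact: mf.
Qed.

End rV_measurable_fun.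

(** One step of the recursion on the dimension: the product of the
    one-dimensional Lebesgue measure with [m], carried to ['rV[R]_n.+1]. *)
Section lebesgue_rV_step.
Context (R : realType) (n : nat).
Local Notation T := (measurableTypeR R).
Variable m : {sigma_finite_measure set 'rV[R]_n -> \bar R}.

Definition rV_cons (x : T * 'rV[R]_n) : 'rV[R]_n.+1 :=
  \row_i oapp (x.2 ord0) x.1 (unlift ord0 i).

Lemma measurable_rV_cons : measurable_fun setT rV_cons.
Proof.
apply: measurable_fun_rV => i.
have [j ->|->] := unliftP ord0 i.
- rewrite (_ : (fun _ => _) = (fun x : 'rV[R]_n => x ord0 j : T) \o snd).
    by apply: measurableT_comp => //; exact: measurable_rV_coord.
  by apply/funext => x /=; rewrite mxE liftK.
- rewrite (_ : (fun _ => _) = fst)//.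
  by apply/funext => x /=; rewrite mxE unlift_none.
Qed.

Definition lebesgue_rV_step : set 'rV[R]_n.+1 -> \bar R :=
  pushforward (lebesgue_measure \x m)%E rV_cons.

Let step0 : lebesgue_rV_step set0 = 0%E.
Proof. by rewrite /lebesgue_rV_step /pushforward preimage_set0 measure0. Qed.

Let step_ge0 A : (0 <= lebesgue_rV_step A)%E.
Proof. exact: (measure_ge0 (lebesgue_measure \x m)%E). Qed.

Let step_sigma_additive : semi_sigma_additive lebesgue_rV_step.
Proof.
move=> F mF tF mUF; rewrite /lebesgue_rV_step /pushforward preimage_bigcup.
apply: measure_semi_sigma_additive.
- by move=> k; rewrite -[X in measurable X]setTI; exact: measurable_rV_cons.
- apply/trivIsetP => i j _ _ ij; rewrite -preimage_setI.
  by move/trivIsetP : tF => /(_ i j Logic.I Logic.I ij) ->; rewrite preimage_set0.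
- rewrite -preimage_bigcup -[X in measurable X]setTI.
  exact: measurable_rV_cons.
Qed.

HB.instance Definition _ := isMeasure.Build _ _ _ lebesgue_rV_step
  step0 step_ge0 step_sigma_additive.

Let step_sigma_finite : sigma_finite setT lebesgue_rV_step.
Proof.
have /sigma_finiteP[F [FT ndF Foo]] := sigma_finiteT (@lebesgue_measure R).
have /sigma_finiteP[G [GT ndG Goo]] := sigma_finiteT m.
pose g (x : 'rV[R]_n.+1) : T * 'rV[R]_n :=
  (x ord0 ord0, \row_j x ord0 (lift ord0 j)).
have mg : measurable_fun setT g.
  apply/measurable_fun_pair; first exact: measurable_rV_coord.
  apply: measurable_fun_rV => j.
  rewrite (_ : (fun _ => _) =
    (fun x : 'rV[R]_n.+1 => x ord0 (lift ord0 j) : T)); last first.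
    by apply/funext => x; rewrite mxE.
  exact: measurable_rV_coord.
have mFG k : measurable (F k `*` G k).
  by apply: measurableX; [have [] := Foo k|have [] := Goo k].
exists (fun k => g @^-1` (F k `*` G k)).
  rewrite -preimage_bigcup; apply/seteqP; split => // x _ /=.
  have [i _ Fi] : (\bigcup_i F i) (g x).1 by rewrite -FT.
  have [j _ Gj] : (\bigcup_i G i) (g x).2 by rewrite -GT.
  exists (maxn i j) => //; split.
    by move: Fi; exact/subsetPset/ndF/leq_maxl.
  by move: Gj; exact/subsetPset/ndG/leq_maxr.
move=> k; split; first by rewrite -[X in measurable X]setTI; exact: mg.
rewrite /lebesgue_rV_step /pushforward -comp_preimage.
rewrite (_ : g \o rV_cons = id) ?preimage_id; last first.
  apply/funext => -[t x]; rewrite /g /= mxE unlift_none; congr pair.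
  by apply/rowP => j; rewrite !mxE liftK.
have [mF Fk] := Foo k; have [mG Gk] := Goo k.
by rewrite product_measure1E// lte_mul_pinfty// ge0_fin_numE.
Qed.

HB.instance Definition _ :=
  Measure_isSigmaFinite.Build _ _ _ lebesgue_rV_step step_sigma_finite.

End lebesgue_rV_step.

Fixpoint lebesgue_rV (R : realType) (n : nat) :
    {sigma_finite_measure set 'rV[R]_n -> \bar R} :=
  if n is n'.+1 then lebesgue_rV_step (lebesgue_rV R n')
  else dirac (0 : 'rV[R]_0).
Arguments lebesgue_rV : clear implicits.

(** ** Euclidean geometry

    The norm and the balls that the library puts on ['rV[R]_n] are those of the
    sup norm, hence the Euclidean versions below; the topology is the same. *)
Section euclidean.
Context (R : realType) (n : nat).
Implicit Types (x y xi : 'rV[R]_n) (A E Omega : set 'rV[R]_n).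

Definition enorm x : R := Num.sqrt (\sum_i x ord0 i ^+ 2).

Definition eball x (r : R) : set 'rV[R]_n := [set y | enorm (y - x) < r].

Definition boundary A : set 'rV[R]_n := closure A `\` interior A.

Definition dist_boundary Omega x : R :=
  inf [set enorm (x - xi) | xi in boundary Omega].

Definition domain Omega := [/\ Omega !=set0, open Omega & connected Omega].

Definition half_open_segment x xi : set 'rV[R]_n :=
  [set (1 - t) *: x + t *: xi | t in `[0, 1[].

Definition dir_boundary Omega x : set 'rV[R]_n :=
  [set xi | boundary Omega xi /\ half_open_segment x xi `<=` Omega].

(** Covers are indexed by arbitrary sets of natural numbers, so that finite
    covers (and the empty cover of [set0]) are allowed: this matters for
    [lambda = 0]. *)
Definition hausdorff_content (lambda : R) E : \bar R :=
  ereal_inf [set s | exists (I : set nat) (c : nat -> 'rV[R]_n) (r : nat -> R),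
    [/\ forall i, I i -> 0 < r i,
        E `<=` \bigcup_(i in I) eball (c i) (r i) &
        s = (\esum_(i in I) (r i `^ lambda)%:E)%E]].

End euclidean.

(** ** Test functions and the Hardy inequality *)
Section hardy.
Context (R : realType) (n : nat).
Implicit Types (u : 'rV[R]_n -> R) (Omega : set 'rV[R]_n).

Definition partial (i : 'I_n) u : 'rV[R]_n -> R :=
  fun x => 'D_(delta_mx ord0 i) u x.

(** [s] is a multi-index, listed as a sequence of directions. *)
Definition iter_partial (s : seq 'I_n) u : 'rV[R]_n -> R :=
  foldr partial u s.

Definition smooth u := forall s : seq 'I_n,
  continuous (iter_partial s u) /\
  forall i x, derivable (iter_partial s u) x (delta_mx ord0 i).

Definition tsupport u : set 'rV[R]_n := closure [set x | u x != 0].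

(** Elements of [C_c^oo(Omega)] are represented by their extension by zero. *)
Definition test_function Omega u :=
  [/\ smooth u, compact (tsupport u) & tsupport u `<=` Omega].

Definition gradient u x : 'rV[R]_n := \row_i partial i u x.

Definition hardy_inequality Omega (p beta : R) := exists2 C : R, 0 < C &
  forall u, test_function Omega u ->
  (\int[lebesgue_rV R n]_(x in Omega)
     (`|u x| `^ p * dist_boundary Omega x `^ (beta - p))%:E
   <= C%:E * \int[lebesgue_rV R n]_(x in Omega)
     (enorm (gradient u x) `^ p * dist_boundary Omega x `^ beta)%:E)%E.

End hardy.

(** Lehrbaeck's theorem in dimension [n].  The condition [Omega != setT] is
    implicit in the use of the distance to the boundary. *)
Definition lehrback_theorem (R : realType) (n : nat) : Prop :=
  forall (Omega : set 'rV[R]_n) (p lambda c : R),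
  open Omega -> Omega != setT -> 1 < p ->
  0 <= lambda -> lambda <= n%:R - 1 -> 0 < c ->
  (forall x, Omega x ->
    ((c * dist_boundary Omega x `^ lambda)%:E <=
     hausdorff_content lambda
       (boundary Omega `&` eball x (2 * dist_boundary Omega x)))%E) ->
  forall beta : R, beta < p - n%:R + lambda -> hardy_inequality Omega p beta.

(* Main.v *)
Require Import Defs.
From mathcomp Require Import all_boot all_order all_algebra.
From mathcomp Require Import all_classical all_reals all_analysis.
From mathcomp Require Import ring lra.

Set Implicit Arguments.
Unset Strict Implicit.
Unset Printing Implicit Defensive.

Import Order.TTheory GRing.Theory Num.Theory.
Import numFieldNormedType.Exports.

Local Open Scope classical_set_scope.
Local Open Scope ring_scope.

(** Lehrbaeck's theorem asks for a lower bound on the content of the boundary in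
    the balls [B(x, 2 d(x))], whereas the hypothesis provides one in the larger
    balls [B(x, C0 d(x))].  Enlarging the balls is harmless because the
    hypothesis holds at every point: moving from [x] towards an almost nearest
    boundary point [xi], one reaches a point [x'] whose distance to the boundary
    is a small but fixed fraction of [d(x)], namely at least
    [d(x) / (2 (C0 + 1))] and at most [d(x) / C0], while [x'] is still closer
    than [d(x)] to [x] ([exists_closer_to_boundary]).  Then [B(x', C0 d(x'))] is
    contained in [B(x, 2 d(x))], and monotonicity of the content turns the
    hypothesis at [x'] into Lehrbaeck's condition at [x], with the constant
    multiplied by [(2 (C0 + 1))^-lambda].

    A boundary point visible from [x'] need not be visible from [x]: passing from
    the visible part to the full boundary is what allows the base point to
    move. *)

(** * The Euclidean norm *)
Section enorm_theory.
Context {R : realType} {n : nat}.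
Implicit Types (x y : 'rV[R]_n).

Lemma enorm_ge0 x : 0 <= enorm x.
Proof. exact: sqrtr_ge0. Qed.

Lemma sqr_enorm x : enorm x ^+ 2 = \sum_i x ord0 i ^+ 2.
Proof. by rewrite sqr_sqrtr// sumr_ge0// => i _; exact: sqr_ge0. Qed.

Lemma enormN x : enorm (- x) = enorm x.
Proof.
by congr Num.sqrt; apply: eq_bigr => i _; rewrite mxE sqrrN.
Qed.

Lemma enormB x y : enorm (x - y) = enorm (y - x).
Proof. by rewrite -enormN opprB. Qed.

Lemma enormZ (a : R) x : 0 <= a -> enorm (a *: x) = a * enorm x.
Proof.
move=> a0; rewrite /enorm -[X in X * _](ger0_norm a0) -sqrtr_sqr.
rewrite -sqrtrM ?sqr_ge0// mulr_sumr.
by congr Num.sqrt; apply: eq_bigr => i _; rewrite mxE exprMn.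
Qed.

Lemma normr_coord_le_enorm x i : `|x ord0 i| <= enorm x.
Proof.
rewrite -sqrtr_sqr ler_wsqrtr// (bigD1 i)//= lerDl.
by rewrite sumr_ge0// => j _; exact: sqr_ge0.
Qed.

Lemma enorm_cauchy_schwarz x y :
  \sum_i x ord0 i * y ord0 i <= enorm x * enorm y.
Proof.
have [x0|x_neq0] := eqVneq (enorm x) 0.
  rewrite x0 mul0r big1// => i _; apply/eqP; rewrite mulf_eq0; apply/orP; left.
  by rewrite -normr_le0 -x0 normr_coord_le_enorm.
have [y0|y_neq0] := eqVneq (enorm y) 0.
  rewrite y0 mulr0 big1// => i _; apply/eqP; rewrite mulf_eq0; apply/orP; right.
  by rewrite -normr_le0 -y0 normr_coord_le_enorm.
have xy_gt0 : 0 < enorm x * enorm y.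
  by rewrite mulr_gt0// lt_neqAle eq_sym enorm_ge0 andbT.
(* summing 0 <= (|y| x_i - |x| y_i)^2 over i *)
have : 0 <= \sum_i (enorm y * x ord0 i - enorm x * y ord0 i) ^+ 2.
  by apply: sumr_ge0 => i _; exact: sqr_ge0.
rewrite (eq_bigr (fun i => enorm y ^+ 2 * x ord0 i ^+ 2
  + enorm x ^+ 2 * y ord0 i ^+ 2
  - (2 * (enorm x * enorm y)) * (x ord0 i * y ord0 i))); last first.
  by move=> i _; ring.
rewrite big_split/= big_split/= sumrN -!mulr_sumr -!sqr_enorm => h.
rewrite -(ler_pM2l xy_gt0); lra.
Qed.

Lemma ler_enormD x y : enorm (x + y) <= enorm x + enorm y.
Proof.
rewrite -(@ler_pXn2r _ 2)// ?nnegrE ?addr_ge0 ?enorm_ge0//.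
rewrite sqr_enorm (eq_bigr (fun i => x ord0 i ^+ 2 + y ord0 i ^+ 2
  + 2 * (x ord0 i * y ord0 i))); last by move=> i _; rewrite !mxE; ring.
rewrite big_split/= big_split/= -mulr_sumr -!sqr_enorm.
have := enorm_cauchy_schwarz x y; lra.
Qed.

Lemma ler_enorm_distD z x y : enorm (x - y) <= enorm (x - z) + enorm (z - y).
Proof. by rewrite (le_trans _ (ler_enormD _ _))// addrA subrK. Qed.

(** The library's balls are those of the sup norm, which the Euclidean norm
    dominates; this is how openness is used with Euclidean distances. *)
Lemma eball_sub_ball x (e : R) : eball x e `<=` ball x e.
Proof.
move=> y xy; split; first exact: le_lt_trans (enorm_ge0 _) xy.
move=> i j; rewrite [i]ord1 /ball/=.
have := normr_coord_le_enorm (x - y) j.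
by rewrite !mxE => /le_lt_trans; apply; rewrite enormB.
Qed.

End enorm_theory.

(** * The distance to the boundary *)
Section dist_boundary_theory.
Context {R : realType} {n : nat}.
Implicit Types (x y : 'rV[R]_n) (Omega : set 'rV[R]_n).

Lemma dist_boundary_le Omega x xi :
  boundary Omega xi -> dist_boundary Omega x <= enorm (x - xi).
Proof.
move=> bxi; apply: ge_inf; last by exists xi.
by exists 0 => _ [z _ <-]; exact: enorm_ge0.
Qed.

Lemma dist_boundary_lipschitz Omega x y : boundary Omega !=set0 ->
  dist_boundary Omega x <= dist_boundary Omega y + enorm (x - y).
Proof.
move=> [xi0 bxi0]; rewrite -lerBlDr; apply: lb_le_inf.
  by exists (enorm (y - xi0)), xi0.
move=> _ [xi bxi <-]; rewrite lerBlDr [leRHS]addrC.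
exact: le_trans (dist_boundary_le x bxi) (ler_enorm_distD y x xi).
Qed.

(** Otherwise the parameters of the segment that are mapped into [Omega] would
    form a nonempty clopen proper subset of [[0, 1]]. *)
Lemma boundary_meets_segment Omega x y : open Omega -> Omega x -> ~ Omega y ->
  exists2 t : R, 0 <= t <= 1 & boundary Omega (x + t *: (y - x)).
Proof.
move=> oO Ox nOy; apply: contrapT => nb.
pose f (t : R) := x + t *: (y - x).
have cf : continuous f.
  by move=> t; apply: cvgD; [exact: cvg_cst|apply: cvgZr_tmp; exact: cvg_id].
have f01 : `[0, 1]%classic `&` f @^-1` Omega = `[0, 1]%classic.
  apply: segment_connected.
  - by exists 0; split; rewrite /= ?in_itv/= ?lexx ?ler01// /f scale0r addr0.
  - by exists (f @^-1` Omega) => //; apply: open_comp => // t _; exact: cf.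
  - exists (f @^-1` closure Omega).
      by apply: closed_comp => [t _|]; [exact: cf|exact: closed_closure].
    apply/seteqP; split => t [t01 Ot]; split => //; first exact: subset_closure.
    apply: contrapT => nOt; apply: nb; exists t; first by move: t01; rewrite /= in_itv.
    by split => // /interior_subset.
have : (`[0, 1]%classic `&` f @^-1` Omega) 1 by rewrite f01 /= in_itv/= ler01 lexx.
by case=> _; rewrite /= /f scale1r addrC subrK.
Qed.

Lemma boundary_nonempty Omega : open Omega -> Omega !=set0 -> Omega != setT ->
  boundary Omega !=set0.
Proof.
move=> oO [x Ox] /setTPn[y nOy].
by have [t _ bt] := boundary_meets_segment oO Ox nOy; exists (x + t *: (y - x)).
Qed.

Lemma dist_boundary_gt0 Omega x : open Omega -> Omega != setT -> Omega x ->
  0 < dist_boundary Omega x.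
Proof.
move=> oO OT Ox.
have [xi0 bxi0] : boundary Omega !=set0.
  by apply: boundary_nonempty => //; exists x.
have /nbhs_ballP[e e0 xeO] := open_nbhs_nbhs (conj oO Ox).
apply: (lt_le_trans e0); apply: lb_le_inf; first by exists (enorm (x - xi0)), xi0.
move=> _ [xi [_ nOxi] <-]; rewrite leNgt enormB; apply/negP => xi_near.
by apply: nOxi; rewrite (iffLR (interior_id _) oO); exact/xeO/eball_sub_ball.
Qed.

Lemma eball_dist_boundary Omega x : open Omega -> Omega x ->
  eball x (dist_boundary Omega x) `<=` Omega.
Proof.
move=> oO Ox y xy; apply: contrapT => nOy.
have [t /andP[t0 t1] bt] := boundary_meets_segment oO Ox nOy.
have := dist_boundary_le x bt.
rewrite opprD addNKr enormN enormZ// leNgt => /negP; apply.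
by rewrite (le_lt_trans _ xy)// ler_piMl ?enorm_ge0.
Qed.

(** With [K / (K + 1)] for the fraction of the segment to be travelled, the
    distance from [x'] to [xi] is about [d(x) / (K + 1)].  The gap between that
    and [d(x) / K] leaves room for [xi] to be only an almost nearest boundary
    point, which costs the factor [2] in the lower bound. *)
Lemma exists_closer_to_boundary Omega x (K : R) :
  open Omega -> Omega != setT -> Omega x -> 0 < K ->
  exists x', [/\ Omega x', enorm (x' - x) < dist_boundary Omega x,
    (2 * (K + 1))^-1 * dist_boundary Omega x <= dist_boundary Omega x' &
    K * dist_boundary Omega x' <= dist_boundary Omega x].
Proof.
move=> oO OT Ox K0; set d := dist_boundary Omega.
have bO : boundary Omega !=set0 by apply: boundary_nonempty => //; exists x.
have d0 : 0 < d x by exact: dist_boundary_gt0.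
have K10 : 0 < K + 1 by lra.
have hinf : has_inf [set enorm (x - xi) | xi in boundary Omega].
  case: bO => xi bxi; split; first by exists (enorm (x - xi)), xi.
  by exists 0 => _ [z _ <-]; exact: enorm_ge0.
(* with this tolerance [x'] is at worst halfway between the sphere of radius [d x] around
   [x] and the point at fraction [K / (K + 1)] of an exactly nearest [xi] *)
have eps0 : 0 < d x / (2 * K) by rewrite divr_gt0// mulr_gt0.
have [_ [xi bxi <-]] := inf_adherent eps0 hinf.
rewrite -/(dist_boundary Omega x) -/(d x) => xi_near.
set x' := x + (K / (K + 1)) *: (xi - x).
have K1V : 1 - K / (K + 1) = (K + 1)^-1 by field; lra.
have x'x : enorm (x' - x) = K / (K + 1) * enorm (x - xi).
  by rewrite /x' addrC addKr enormZ ?(enormB x)// divr_ge0// ltW.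
have x'xi : enorm (x' - xi) = (K + 1)^-1 * enorm (x - xi).
  rewrite (_ : x' - xi = (K + 1)^-1 *: (x - xi)) ?enormZ ?invr_ge0 ?ltW//.
  rewrite -K1V scalerBl scale1r /x' -[xi - x]opprB scalerN.
  by rewrite addrAC.
have {}x'x : enorm (x' - x) < d x - (2 * (K + 1))^-1 * d x.
  rewrite x'x (_ : _ - _ = K / (K + 1) * (d x + d x / (2 * K))); last first.
    by field; apply/andP; split; lra.
  by rewrite ltr_pM2l// divr_gt0.
have lt_d : enorm (x' - x) < d x.
  by rewrite (lt_trans x'x)// ltrBlDr ltrDl mulr_gt0// invr_gt0; lra.
exists x'; split => //.
- exact: eball_dist_boundary lt_d.
- have := @dist_boundary_lipschitz _ x x' bO; rewrite -/(d x) -/(d x') enormB.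
  lra.
- apply: (@le_trans _ _ (K * enorm (x' - xi))).
    by rewrite ler_pM2l//; exact: dist_boundary_le.
  rewrite x'xi mulrA -[K / _]invf_div ler_pdivrMl ?divr_gt0//.
  apply/ltW/(lt_le_trans xi_near).
  rewrite (_ : _ / K * _ = d x + d x / K); last by field; lra.
  rewrite lerD2l ler_pM2l// lef_pV2 ?posrE//; lra.
Qed.

End dist_boundary_theory.

(** * Hausdorff content and the Hardy inequality *)

Lemma le_hausdorff_content {R : realType} {n : nat} (lambda : R)
    (E F : set 'rV[R]_n) :
  E `<=` F -> (hausdorff_content lambda E <= hausdorff_content lambda F)%E.
Proof.
move=> EF; apply: ereal_inf_le_tmp => _ [I [c [r [r0 Fc ->]]]].
by exists I, c, r; split => //; exact: subset_trans Fc.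
Qed.

Theorem proposition6p1 (R : realType) (n : nat)
    (lehrback : lehrback_theorem R n)
    (Omega : set 'rV[R]_n) (p c0 C0 lambda : R)
    (domain_Omega : domain Omega) (Omega_proper : Omega != setT)
    (p_gt1 : 1 < p) (c0_gt0 : 0 < c0) (C0_ge2 : 2 <= C0)
    (lambda_ge0 : 0 <= lambda) (lambda_le : lambda <= n%:R - 1)
    (content_ge : forall x, Omega x ->
      ((c0 * dist_boundary Omega x `^ lambda)%:E <=
       hausdorff_content lambda
         (dir_boundary Omega x `&` eball x (C0 * dist_boundary Omega x)))%E) :
  forall beta : R, beta < p - n%:R + lambda -> hardy_inequality Omega p beta.
Proof.
case: domain_Omega => _ oO _.
have C0_gt0 : 0 < C0 by lra.
pose a := (2 * (C0 + 1))^-1.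
have a_gt0 : 0 < a by rewrite invr_gt0; lra.
apply: (lehrback _ _ lambda (c0 * a `^ lambda)) => //.
  by rewrite mulr_gt0// powR_gt0.
move=> x Ox.
have dx_gt0 := dist_boundary_gt0 oO Omega_proper Ox.
have [x' [Ox' x'x dx'_ge dx'_le]] :=
  exists_closer_to_boundary oO Omega_proper Ox C0_gt0.
apply: (@le_trans _ _ (c0 * dist_boundary Omega x' `^ lambda)%:E).
  rewrite lee_fin -mulrA ler_pM2l// -powRM ?(ltW a_gt0) ?(ltW dx_gt0)//.
  by apply: ge0_ler_powR; rewrite // nnegrE ltW ?mulr_gt0// dist_boundary_gt0.
apply: (le_trans (content_ge x' Ox')); apply: le_hausdorff_content.
move=> y [[by_ _] yx']; split => //.
rewrite /eball/= in yx' *.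
have := ler_enorm_distD x' y x; lra.
Qed.
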